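(* Let $\alpha,\beta$ be positive real numbers and endow $\mathbb{R}$ with the asymmetric norm $\|x\|:=\max(-\alpha x,\beta x)$ and the associated weak metric $\delta(x,y):=\|y-x\|$. Then a non-expansive mapping $T\colon\mathbb{R}\to\mathbb{R}$ is not firm if and only if, for every $\epsilon>0$, there exist distinct points $x$ and $y$ in $\mathbb{R}$ such that $\|Tx-y\|$ and $\|Ty-z_{xy}\|$ are both less than $\|y-x\|\,\epsilon$, where $z_{xy}$ denotes the unique element of $\mathbb{R}$ such that $\|z_{xy}-y\|=\|y-x\|$ and $(y-x)(z_{xy}-y)<0$.
   Context: A weak metric on a set $X$ is a mapping $\delta\colon X\times X\to[0,+\infty[$ such that $\delta(x,x)=0$ for every $x\in X$ and $\delta(x,z)\leq\delta(x,y)+\delta(y,z)$ for every $x,y,z\in X$ (no symmetry required). A mapping $T\colon X\to X$ of a weak metric space $(X,\delta)$ is non-expansive if $\delta(Tx,Ty)\leq\delta(x,y)$ for every $x,y\in X$. A mapping $T\colon X\to X$ is firm if there exist mappings $q,r,s,t\colon X\times X\to[0,+\infty[$ such that (A) $\inf_{(x,y)\in X\times X}t(x,y)>0$; (B) $\sup_{(x,y)\in X\times X}\big(q(x,y)+r(x,y)+s(x,y)+2t(x,y)\big)\leq 1$; (C) for every $x,y\in X$, $$\delta(Tx,Ty)\leq q(x,y)\,\delta(x,y)+r(x,y)\,\delta(x,Tx)+s(x,y)\,\delta(y,Ty)+t(x,y)\big[\delta(x,Ty)+\delta(Tx,y)\big].$$ *)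

(* Defs.v *)
From mathcomp Require Import all_boot all_order all_algebra.
From mathcomp Require Import all_classical all_reals all_analysis.
From mathcomp Require Import lra.
Set Implicit Arguments.
Unset Strict Implicit.
Unset Printing Implicit Defensive.
Import Order.TTheory GRing.Theory Num.Theory.
Import numFieldNormedType.Exports.
Local Open Scope classical_set_scope.
Local Open Scope ring_scope.

Definition weak_metric (R : realType) (X : Type) (d : X -> X -> R) : Prop :=
  [/\ forall x y, 0 <= d x y,
      forall x, d x x = 0 &
      forall x y z, d x z <= d x y + d y z].

Definition nonexpansive (R : realType) (X : Type) (d : X -> X -> R)
    (T : X -> X) : Prop :=
  forall x y, d (T x) (T y) <= d x y.

(* The infimum and supremum are taken in the extended reals: the real-valued
   [sup] is 0 on sets that are not bounded above, which would make the second
   condition vacuous there. *)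
Definition firm (R : realType) (X : Type) (d : X -> X -> R)
    (T : X -> X) : Prop :=
  exists q r s t : X * X -> R,
    [/\ forall p, [/\ 0 <= q p, 0 <= r p, 0 <= s p & 0 <= t p],
        (0 < ereal_inf (range (fun p => (t p)%:E)))%E,
        (ereal_sup (range (fun p => (q p + r p + s p + 2 * t p)%:E)) <= 1)%E &
        forall x y,
          d (T x) (T y) <=
            q (x, y) * d x y + r (x, y) * d x (T x) + s (x, y) * d y (T y)
            + t (x, y) * (d x (T y) + d (T x) y)].

Definition asym_norm (R : realType) (a b x : R) : R :=
  Num.max (- a * x) (b * x).

Definition asym_dist (R : realType) (a b x y : R) : R :=
  asym_norm a b (y - x).

Definition is_zxy (R : realType) (a b x y z : R) : Prop :=
  asym_norm a b (z - y) = asym_norm a b (y - x) /\ (y - x) * (z - y) < 0.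

(* Definite description; [is_zxy_unique] below shows that it is meaningful
   whenever [x != y]. *)
Definition zxy (R : realType) (a b x y : R) : R :=
  get [set z | is_zxy a b x y z].

Lemma asym_dist_weak_metric (R : realType) (a b : R) :
  0 < a -> 0 < b -> weak_metric (asym_dist a b).
Proof.
move=> a0 b0; split=> [x y|x|x y z]; rewrite /asym_dist /asym_norm.
- by rewrite le_max; case: (leP 0 (y - x)) => h; apply/orP;
    [right|left]; nra.
- by rewrite subrr !mulr0 maxxx.
- rewrite ge_max; apply/andP; split.
  + have -> : - a * (z - x) = - a * (y - x) + - a * (z - y) by lra.
    by apply: lerD; rewrite le_max lexx.
  + have -> : b * (z - x) = b * (y - x) + b * (z - y) by lra.
    by apply: lerD; rewrite le_max lexx orbT.
Qed.

Lemma asym_norm_ge0E (R : realType) (a b x : R) :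
  0 < a -> 0 < b -> 0 <= x -> asym_norm a b x = b * x.
Proof. by move=> a0 b0 x0; apply/max_idPr; nra. Qed.

Lemma asym_norm_le0E (R : realType) (a b x : R) :
  0 < a -> 0 < b -> x <= 0 -> asym_norm a b x = - a * x.
Proof. by move=> a0 b0 x0; apply/max_idPl; nra. Qed.

Lemma is_zxy_unique (R : realType) (a b x y : R) :
  0 < a -> 0 < b -> x != y -> exists! z, is_zxy a b x y z.
Proof.
move=> a0 b0; rewrite /is_zxy neq_lt => /orP[] xy.
- have c0 : 0 < b * (y - x) / a by rewrite divr_gt0// mulr_gt0// subr_gt0.
  have ac : a * (b * (y - x) / a) = b * (y - x) by rewrite mulrCA divff ?mulr1 ?gt_eqF.
  exists (y - b * (y - x) / a); split.
    split; last by nra.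
    by rewrite asym_norm_le0E ?asym_norm_ge0E//; lra.
  move=> z [+ zl]; have zy : z - y < 0 by nra.
  rewrite asym_norm_le0E ?asym_norm_ge0E//; [|lra|lra] => zE.
  by apply: (mulfI (lt0r_neq0 a0)); lra.
- have c0 : 0 < a * (x - y) / b by rewrite divr_gt0// mulr_gt0// subr_gt0.
  have bc : b * (a * (x - y) / b) = a * (x - y) by rewrite mulrCA divff ?mulr1 ?gt_eqF.
  exists (y + a * (x - y) / b); split.
    split; last by nra.
    by rewrite asym_norm_ge0E ?asym_norm_le0E//; lra.
  move=> z [+ zl]; have zy : 0 < z - y by nra.
  rewrite asym_norm_ge0E ?asym_norm_le0E//; [|lra|lra] => zE.
  by apply: (mulfI (lt0r_neq0 b0)); lra.
Qed.

Lemma zxyP (R : realType) (a b x y : R) :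
  0 < a -> 0 < b -> x != y -> is_zxy a b x y (zxy a b x y).
Proof.
move=> a0 b0 xy; have [z [zP _]] := is_zxy_unique a0 b0 xy.
exact: (@getPex _ [set z | is_zxy a b x y z] (ex_intro _ z zP)).
Qed.

(* Main.v *)
Require Import Defs.
From mathcomp Require Import all_boot all_order all_algebra.
From mathcomp Require Import all_classical all_reals all_analysis.
From mathcomp Require Import ring lra.
Import Order.TTheory GRing.Theory Num.Theory.
Local Open Scope ring_scope.

(** The existence of the four coefficients is a condition on each pair [(x, y)]
    separately, coupled only through a uniform positive lower bound for [t]
    ([firm_pointwise]).  For one pair, put [D = d (T x) (T y)],
    [M = max (d x y, d x (T x), d y (T y))] and
    [P = d x (T y) + d (T x) y].  Coefficients exist as soon as [2 D <= P]
    (take [t = 1/2]) or [D <= (1 - k) M] (take [t = k/2] and put the weight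
    [1 - k] on a largest term).  So if [T] is not firm, then for every small
    [k] some pair has [P < 2 D] and [(1 - k) M < D] ([not_firm_pair]).

    On the line, say with [x < y], the first inequality forces
    [T y < T x]: otherwise [D] and [d x y] are both [beta] times a signed
    length, and [P >= beta (T y - x) + beta (y - T x) = D + d x y >= 2 D].  So [T] reverses the order of
    [x] and [y]; moreover [D] almost equals [d x y], whereas [T x] is
    at most about [d x y] away from [x] and [T y] at most about [d x y]
    away from [y].  As [T x] cannot go much beyond [y], nor [T y] much
    below [z_xy], the only way for [D] to be that large is
    that [T x] is close to [y] and [T y] to [z_xy] ([near_reversal]).

    Conversely, at a pair with [T x] close to [y] and [T y] close to [z_xy],
    the numbers [D] and [M] are both about [d x y], whereas [P] is
    about [d x z_xy], which is at most [d x y] because the steps from [x] to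
    [y] and from [y] to [z_xy] go in opposite directions.  The right-hand side
    of the firmness inequality is then at most about
    [(1 - 2 t + t) d x y = (1 - t) d x y], which falls short of [D] once the
    approximation is fine compared with [t] ([reversal_bounds_t]). *)

(** * Firmness one pair at a time *)

(** A uniform lower bound on [t] is all that links different pairs, so choice
    turns coefficients found pair by pair into functions. *)
Lemma firm_pointwise (R : realType) (X : Type) (d : X -> X -> R) (T : X -> X) :
  firm d T <->
  exists2 t0 : R, 0 < t0 &
    forall x y, exists q r s t : R,
      [/\ [/\ 0 <= q, 0 <= r, 0 <= s & t0 <= t],
          q + r + s + 2 * t <= 1 &
          d (T x) (T y) <= q * d x y + r * d x (T x) + s * d y (T y)
                           + t * (d x (T y) + d (T x) y)].
Proof.
split=> [[q [r [s [t [pos inft supC ineq]]]]]|[t0 t0_gt0 coef]].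
- have [t0 t0_gt0 t0_le] : exists2 t0 : R, 0 < t0 & forall p, t0 <= t p.
    have inf_le p : (ereal_inf (range (fun p => (t p)%:E)) <= (t p)%:E)%E.
      by apply: ereal_inf_lbound; exists p.
    case: (ereal_inf _) inft inf_le => [t0||] //= t0_gt0 t0_le.
    + by exists t0 => [|p]; rewrite -?lte_fin -?lee_fin.
    + (* the infimum is infinite only when there are no pairs *)
      by exists 1 => // p; have := t0_le p; rewrite leye_eq.
  exists t0 => // x y.
  exists (q (x, y)), (r (x, y)), (s (x, y)), (t (x, y)); split=> //.
  + by have [] := pos (x, y).
  + rewrite -lee_fin; apply: le_trans supC.
    by apply: ereal_sup_ubound; exists (x, y).
- have /choice[c cP] : forall p : X * X, exists c : R * R * R * R,
    [/\ [/\ 0 <= c.1.1.1, 0 <= c.1.1.2, 0 <= c.1.2 & t0 <= c.2],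
        c.1.1.1 + c.1.1.2 + c.1.2 + 2 * c.2 <= 1 &
        d (T p.1) (T p.2) <=
          c.1.1.1 * d p.1 p.2 + c.1.1.2 * d p.1 (T p.1)
          + c.1.2 * d p.2 (T p.2)
          + c.2 * (d p.1 (T p.2) + d (T p.1) p.2)].
    move=> [x y]; have [q [r [s [t H]]]] := coef x y.
    by exists (q, r, s, t).
  exists (fun p => (c p).1.1.1), (fun p => (c p).1.1.2),
    (fun p => (c p).1.2), (fun p => (c p).2); split.
  + move=> p; have [[q0 r0 s0 tt0] _ _] := cP p; split=> //.
    exact: le_trans (ltW t0_gt0) tt0.
  + apply: (@lt_le_trans _ _ t0%:E); first by rewrite lte_fin.
    apply: le_ereal_inf_tmp => _ [p _ <-].
    by have [[_ _ _]] := cP p; rewrite lee_fin.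
  + apply: ge_ereal_sup => _ [p _ <-].
    by have [_ + _] := cP p; rewrite lee_fin.
  + by move=> x y; have [_ _] := cP (x, y).
Qed.

(** If every pair violated one of these four inequalities, the coefficients
    [t = 1/2], or [t = k/2] together with a single weight [1 - k], would make
    [T] firm. *)
Lemma not_firm_pair {R : realType} {X : Type} {d : X -> X -> R} {T : X -> X}
    (d_ge0 : forall x y, 0 <= d x y) {k : R} :
  0 < k -> k <= 1 -> ~ firm d T ->
  exists x y,
    [/\ d x (T y) + d (T x) y < 2 * d (T x) (T y),
        (1 - k) * d x y < d (T x) (T y),
        (1 - k) * d x (T x) < d (T x) (T y) &
        (1 - k) * d y (T y) < d (T x) (T y)].
Proof.
move=> k0 k1 nfirm; apply: contrapT => nopair; apply: nfirm.
apply/firm_pointwise; exists (k / 2) => [|x y]; first by lra.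
have W0 := d_ge0 x y; have X0 := d_ge0 x (T x); have Y0 := d_ge0 y (T y).
have P1 := d_ge0 x (T y); have P2 := d_ge0 (T x) y.
have kP : 0 <= k * (d x (T y) + d (T x) y) by apply: mulr_ge0; lra.
have [h1|h1] := leP (2 * d (T x) (T y)) (d x (T y) + d (T x) y).
  by exists 0, 0, 0, (1 / 2); do !split; lra.
have [h2|h2] := leP (d (T x) (T y)) ((1 - k) * d x y).
  by exists (1 - k), 0, 0, (k / 2); do !split; lra.
have [h3|h3] := leP (d (T x) (T y)) ((1 - k) * d x (T x)).
  by exists 0, (1 - k), 0, (k / 2); do !split; lra.
have [h4|h4] := leP (d (T x) (T y)) ((1 - k) * d y (T y)).
  by exists 0, 0, (1 - k), (k / 2); do !split; lra.
by case: nopair; exists x, y.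
Qed.

(** * The asymmetric norm on the line *)

Section AsymNorm.
Context {R : realType}.
Implicit Types a b x y z u v : R.

Lemma asym_norm_ge0 {a b} x : 0 < a -> 0 < b -> 0 <= asym_norm a b x.
Proof.
move=> a0 b0; rewrite /asym_norm le_max.
by apply/orP; case: (leP 0 x) => h; [right|left]; nra.
Qed.

Lemma asym_normD a b x y :
  asym_norm a b (x + y) <= asym_norm a b x + asym_norm a b y.
Proof.
by rewrite {1}/asym_norm ge_max !mulrDr; apply/andP; split;
  apply: lerD; rewrite /asym_norm le_max lexx ?orbT.
Qed.

Lemma asym_norm_swap a b x : asym_norm a b (- x) = asym_norm b a x.
Proof. by rewrite /asym_norm maxC mulrN mulNr mulrN mulNr opprK. Qed.

Lemma asym_norm_lt a b x c :
  (asym_norm a b x < c) = (- a * x < c) && (b * x < c).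
Proof. by rewrite /asym_norm gt_max. Qed.

Lemma asym_norm_ge a b x : - a * x <= asym_norm a b x /\ b * x <= asym_norm a b x.
Proof. by rewrite /asym_norm !le_max !lexx orbT. Qed.

Lemma asym_normN_le {a b} x : 0 < a -> 0 < b ->
  asym_norm a b (- x) <= (a / b + b / a) * asym_norm a b x.
Proof.
move=> a0 b0; have ab := divr_gt0 a0 b0; have ba := divr_gt0 b0 a0.
have abE : a / b * b = a by rewrite divfK ?gt_eqF.
have baE : b / a * a = b by rewrite divfK ?gt_eqF.
have N0 := asym_norm_ge0 x a0 b0; have [Na Nb] := asym_norm_ge a b x.
have Nab := mulr_ge0 (ltW ab) N0; have Nba := mulr_ge0 (ltW ba) N0.
rewrite {1}/asym_norm ge_max mulrDl !mulrN; apply/andP; split.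
- have : a / b * (b * x) <= a / b * asym_norm a b x by rewrite ler_pM2l.
  by rewrite mulrA abE; lra.
- have : b / a * (- a * x) <= b / a * asym_norm a b x by rewrite ler_pM2l.
  by rewrite mulrA mulrN baE; lra.
Qed.

Lemma asym_normD_opp {a b x y} : 0 < a -> 0 < b -> x * y <= 0 ->
  asym_norm a b (x + y) <= Num.max (asym_norm a b x) (asym_norm a b y).
Proof.
move=> a0 b0 xy; have [xa xb] := asym_norm_ge a b x.
have [ya yb] := asym_norm_ge a b y.
have x0 := asym_norm_ge0 x a0 b0; have y0 := asym_norm_ge0 y a0 b0.
rewrite le_max {1 3}/asym_norm !ge_max.
have [h|h] := leP 0 x.
- have [h'|h'] := leP 0 y.
    (* two numbers of the same sign: one of them vanishes *)
    have /eqP : x * y = 0 by apply/eqP; rewrite eq_le xy mulr_ge0.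
    rewrite mulf_eq0 => /orP[]/eqP->; first by rewrite add0r ya yb orbT.
    by rewrite addr0 xa xb.
  have [s|s] := leP 0 (x + y); apply/orP; [left|right];
    by apply/andP; split; nra.
- have y_ge0 : 0 <= y by nra.
  have [s|s] := leP 0 (x + y); apply/orP; [right|left];
    by apply/andP; split; nra.
Qed.

Lemma is_zxy_swap {a b x y z} :
  is_zxy a b x y z -> is_zxy b a (- x) (- y) (- z).
Proof.
by rewrite /is_zxy -!opprD !asym_norm_swap mulrNN.
Qed.

(** * Almost extremal pairs are almost reversed *)

(** The points [u] and [v] stand for [T x] and [T y].  The alternative
    [u <= v] contradicts [P < 2 D]; in the alternative [v < u], the
    bounds on [u - x] and [y - v] keep [u] from going
    beyond [y] and [v] below [z], so the length of [u - v] pins both down. *)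
Lemma near_reversal_lt {a b k x y z u v} :
  0 < a -> 0 < b -> 0 < k -> k <= 1 / 2 -> x < y -> is_zxy a b x y z ->
  asym_norm a b (v - u) <= asym_norm a b (y - x) ->
  asym_norm a b (v - x) + asym_norm a b (y - u) < 2 * asym_norm a b (v - u) ->
  (1 - k) * asym_norm a b (y - x) < asym_norm a b (v - u) ->
  (1 - k) * asym_norm a b (u - x) < asym_norm a b (v - u) ->
  (1 - k) * asym_norm a b (v - y) < asym_norm a b (v - u) ->
  asym_norm a b (u - y) < asym_norm a b (y - x) * ((3 + (a / b + b / a)) * k) /\
  asym_norm a b (v - z) < asym_norm a b (y - x) * ((3 + (a / b + b / a)) * k).
Proof.
move=> a0 b0 k0 k1 xy [zE zlt] DW PD WD XD YD.
have zy : z - y <= 0 by nra.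
have WE : asym_norm a b (y - x) = b * (y - x) by rewrite asym_norm_ge0E //; lra.
rewrite asym_norm_le0E // in zE.
have [uv|vu] := leP u v.
  have [_ h1] := asym_norm_ge a b (v - x).
  have [_ h2] := asym_norm_ge a b (y - u).
  have DE : asym_norm a b (v - u) = b * (v - u).
    by rewrite asym_norm_ge0E //; lra.
  by exfalso; lra.
have DE : asym_norm a b (v - u) = - a * (v - u).
  by rewrite asym_norm_le0E //; lra.
set W := asym_norm a b (y - x) in WE zE DW WD *.
have W0 : 0 < W by rewrite WE; nra.
have kW : 0 < k * W by exact: mulr_gt0.
(* [1 / (1 - k) <= 1 + 2 k] for [k <= 1/2] *)
have inv_bound n : (1 - k) * n < asym_norm a b (v - u) -> n < W + 2 * (k * W).
  by move=> h; rewrite ltNge; apply/negP => hn; nra.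
have {}XD := inv_bound _ XD; have {}YD := inv_bound _ YD.
have [_ ux] := asym_norm_ge a b (u - x).
have [vy _] := asym_norm_ge a b (v - y).
have ab := divr_gt0 a0 b0; have ba := divr_gt0 b0 a0.
have baE w : b / a * (a * w) = b * w by rewrite mulrA divfK ?gt_eqF.
have abW := mulr_gt0 ab kW; have baW := mulr_gt0 ba kW.
have CE : W * ((3 + (a / b + b / a)) * k)
    = 3 * (k * W) + a / b * (k * W) + b / a * (k * W) by ring.
rewrite CE !asym_norm_lt; split; apply/andP; split; try lra.
have avz : a * (v - z) < k * W + a * (u - y) by lra.
have : b / a * (a * (v - z)) < b / a * (k * W + a * (u - y)).
  by rewrite ltr_pM2l.
by rewrite (mulrDr _ (k * W)) !baE; lra.
Qed.

Lemma near_reversal {a b k x y z u v} :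
  0 < a -> 0 < b -> 0 < k -> k <= 1 / 2 -> x != y -> is_zxy a b x y z ->
  asym_norm a b (v - u) <= asym_norm a b (y - x) ->
  asym_norm a b (v - x) + asym_norm a b (y - u) < 2 * asym_norm a b (v - u) ->
  (1 - k) * asym_norm a b (y - x) < asym_norm a b (v - u) ->
  (1 - k) * asym_norm a b (u - x) < asym_norm a b (v - u) ->
  (1 - k) * asym_norm a b (v - y) < asym_norm a b (v - u) ->
  asym_norm a b (u - y) < asym_norm a b (y - x) * ((3 + (a / b + b / a)) * k) /\
  asym_norm a b (v - z) < asym_norm a b (y - x) * ((3 + (a / b + b / a)) * k).
Proof.
move=> a0 b0 k0 k1; rewrite neq_lt => /orP[xy|yx] zP.
  exact: near_reversal_lt.
(* the reflection of the line exchanges [a] and [b] *)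
have Nyx : - x < - y by rewrite ltrN2.
have := near_reversal_lt (u := - u) (v := - v) b0 a0 k0 k1 Nyx
  (is_zxy_swap zP).
by rewrite -!opprD !asym_norm_swap (addrC (b / a)).
Qed.

(** * Almost reversed pairs prevent firmness *)

(** With all distances replaced by their limits at an exactly reversed pair,
    the firmness inequality reads [W <= (q + r + s) W + t W <= (1 - t) W];
    the error terms, at most [e W] or [(a / b + b / a) e W] each, can
    only repair it when [t] is at most of order [e]. *)
Lemma reversal_bounds_t {a b e q r s t x y z u v} :
  0 < a -> 0 < b -> 0 < e -> x != y -> is_zxy a b x y z ->
  asym_norm a b (u - y) < asym_norm a b (y - x) * e ->
  asym_norm a b (v - z) < asym_norm a b (y - x) * e ->
  0 <= q -> 0 <= r -> 0 <= s -> 0 <= t -> q + r + s + 2 * t <= 1 ->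
  asym_norm a b (v - u) <=
    q * asym_norm a b (y - x) + r * asym_norm a b (u - x)
    + s * asym_norm a b (v - y)
    + t * (asym_norm a b (v - x) + asym_norm a b (y - u)) ->
  t <= (3 + 2 * (a / b + b / a)) * e.
Proof.
move=> a0 b0 e0 xy [zE zlt] uy vz q0 r0 s0 t0 qrst ineq.
set K := a / b + b / a; have K0 : 0 < K by rewrite addr_gt0 ?divr_gt0.
have NK w c : asym_norm a b w < c -> asym_norm a b (- w) <= K * c.
  move=> wc; apply: le_trans (asym_normN_le _ a0 b0) _.
  by rewrite ler_pM2l // ltW.
have tri p m n : asym_norm a b (p - n)
      <= asym_norm a b (m - n) + asym_norm a b (p - m).
  have -> : p - n = (m - n) + (p - m) by ring.
  exact: asym_normD.
have zx : asym_norm a b (z - x) <= asym_norm a b (y - x).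
  have := asym_normD_opp a0 b0 (ltW zlt).
  by rewrite zE maxxx; have -> : (y - x) + (z - y) = z - x by ring.
have yu := NK _ _ uy; have zv := NK _ _ vz; rewrite !opprB in yu zv.
have hD := tri z u y; have hD' := tri z v u.
have hX := tri u y x; have hY := tri v z y; have hP := tri v z x.
set W := asym_norm a b (y - x) in zE zx yu zv uy vz ineq hX.
have W0 : 0 < W.
  rewrite /W lt_neqAle asym_norm_ge0 // andbT eq_sym; apply/negP => /eqP W0.
  have [Wa Wb] := asym_norm_ge a b (y - x); rewrite W0 in Wa Wb.
  by move/negP: xy; apply; apply/eqP; nra.
have eW0 : 0 < W * e by exact: mulr_gt0.
have KeW0 : 0 < K * (W * e) by exact: mulr_gt0.
have qW : q * W <= q * (W + W * e) by apply: ler_wpM2l; lra.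
have rX : r * asym_norm a b (u - x) <= r * (W + W * e).
  by apply: ler_wpM2l; lra.
have sY : s * asym_norm a b (v - y) <= s * (W + W * e).
  by apply: ler_wpM2l; lra.
have tP : t * (asym_norm a b (v - x) + asym_norm a b (y - u))
    <= t * (W + W * e + K * (W * e)) by apply: ler_wpM2l; lra.
have sumE : q * (W + W * e) + r * (W + W * e) + s * (W + W * e)
    <= (1 - 2 * t) * (W + W * e).
  by rewrite -!mulrDl ler_wpM2r //; lra.
have tK : t * (K * (W * e)) <= 1 * (K * (W * e)) by apply: ler_wpM2r; lra.
have te : 0 <= t * (W * e) by apply: mulr_ge0 => //; lra.
rewrite -(ler_pM2l W0).
have -> : W * ((3 + 2 * K) * e) = 3 * (W * e) + 2 * (K * (W * e)) by ring.
by lra.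
Qed.

End AsymNorm.

(** * The characterisation *)

Theorem proposition3p1 (R : realType) (alpha beta : R)
    (alpha0 : 0 < alpha) (beta0 : 0 < beta) (T : R -> R)
    (Tnonexp : nonexpansive (asym_dist alpha beta) T) :
  ~ firm (asym_dist alpha beta) T <->
  forall eps : R, 0 < eps ->
    exists x y : R,
      [/\ x != y,
          asym_norm alpha beta (T x - y)
            < asym_norm alpha beta (y - x) * eps &
          asym_norm alpha beta (T y - zxy alpha beta x y)
            < asym_norm alpha beta (y - x) * eps].
Proof.
have K0 : 0 < alpha / beta + beta / alpha by rewrite addr_gt0 ?divr_gt0.
split=> [nfirm eps eps0|reversed /firm_pointwise[t0 t0_gt0 coef]].
- have [d_ge0 d_xx _] := asym_dist_weak_metric alpha0 beta0.
  set C := 3 + (alpha / beta + beta / alpha); have C0 : 0 < C by rewrite /C; lra.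
  have epsC := divr_gt0 eps0 C0.
  set k := Num.min (1 / 2) (eps / C).
  have k0 : 0 < k by rewrite lt_min epsC andbT; lra.
  have k1 : k <= 1 / 2 by rewrite ge_min lexx.
  have Ck : C * k <= eps by rewrite mulrC -ler_pdivlMr // ge_min lexx orbT.
  have kle1 : k <= 1 by lra.
  have [x [y [PD WD XD YD]]] := not_firm_pair d_ge0 k0 kle1 nfirm.
  have DW := Tnonexp x y.
  have W0 : 0 < asym_dist alpha beta x y.
    by have := d_ge0 x (T y); have := d_ge0 (T x) y; lra.
  have xy : x != y by apply/eqP => xy; rewrite xy d_xx ltxx in W0.
  have [uy vz] :=
    near_reversal alpha0 beta0 k0 k1 xy (zxyP alpha0 beta0 xy) DW PD WD XD YD.
  by exists x, y; split=> //; [apply: lt_le_trans uy _|apply: lt_le_trans vz _];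
    rewrite ler_pM2l.
- set C := 3 + 2 * (alpha / beta + beta / alpha).
  have C0 : 0 < C by rewrite /C; lra.
  have e0 : 0 < t0 / (2 * C) by rewrite divr_gt0 // mulr_gt0.
  have [x [y [xy uy vz]]] := reversed _ e0.
  have [q [r [s [t [[q0 r0 s0 tt0] qrst ineq]]]]] := coef x y.
  have t_ge0 : 0 <= t by lra.
  have := reversal_bounds_t alpha0 beta0 e0 xy (zxyP alpha0 beta0 xy) uy vz
    q0 r0 s0 t_ge0 qrst ineq.
  have -> : (3 + 2 * (alpha / beta + beta / alpha)) * (t0 / (2 * C)) = t0 / 2.
    by rewrite -/C; field; rewrite gt_eqF.
  by lra.
Qed.
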